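(* Let $r\ge 1$ be an integer, $\epsilon>0$, and let $(x^{(0)},y^{(0)},z^{(0)})$ be a strictly feasible primal-dual initial point, i.e. $Ax^{(0)}=b$, $x^{(0)}>0$, $A^Ty^{(0)}+z^{(0)}=\nabla f(x^{(0)})$, $z^{(0)}>0$; put $\mu^{(0)}=\dfrac{(x^{(0)})^Tz^{(0)}}{n}$ and assume $\Gamma(x^{(0)},z^{(0)},\mu^{(0)})<\dfrac1{e^r}$. If we take $\theta=\dfrac{1}{e^{2r}\sqrt n}$, then the primal-dual algorithm described in the context, started from this point with these parameters, converges to the optimal solution of (P) and (D) after $$\left\lceil e^{2r}\sqrt n\,\log\frac{\mu^{(0)}\left(n+\frac{(r-1)^2}{e^{2r}}\right)}{\epsilon}\right\rceil$$ iterations.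
   Context: Setting: $f:\mathbb R^n\to\mathbb R$ is convex and twice differentiable, $A\in\mathbb R^{m\times n}$ has full rank with $\mathrm{rank}(A)=m<n$, and $b\in\mathbb R^m$. The primal problem (P) is $\min f(x)$ subject to $Ax=b$, $x\ge 0$, and its dual (D) is $\max\ b^Ty+f(x)-x^T\nabla f(x)$ subject to $A^Ty+z=\nabla f(x)$, $z\ge 0$, $y\in\mathbb R^m$. The optimality conditions for (P) and (D) are $Ax=b$, $x\ge0$, $A^Ty+z=\nabla f(x)$, $z\ge0$, $xz=0$. It is assumed that strictly feasible primal-dual points exist, i.e. that there are $(\bar x,\bar y,\bar z)$ with $A\bar x=b$, $\bar x>0$, $A^T\bar y+\bar z=\nabla f(\bar x)$, $\bar z>0$. Notation: for vectors, $xz$, $x/w$, $\sqrt{x}$, $w^r$, inequalities etc. are componentwise; $e_n=(1,\dots,1)^T\in\mathbb R^n$ (whereas $e$, as in $e^r$, is Euler's number); $\|\cdot\|$ is the Euclidean norm; $\lceil\cdot\rceil$ denotes rounding up to an integer. For $x,z>0$ in $\mathbb R^n$ and $\mu>0$ put $w=\sqrt{xz/\mu}$ and $$p_w=\frac{2e_n-2w^r}{r\,w^{r-1}},\qquad \Gamma(x,z,\mu)=\frac{\|p_w\|}{2}=\frac1r\left\|\frac{e_n-w^r}{w^{r-1}}\right\|.$$ The search direction at $(x,y,z)$ with parameter $\mu$ is the solution $(\Delta x,\Delta y,\Delta z)$ of $$A\Delta x=0,\qquad A^T\Delta y+\Delta z=\nabla^2f(x)\Delta x,\qquad z\Delta x+x\Delta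 z=\mu\, w\,p_w .$$ (This is the Newton system obtained from the algebraically transformed central path equation $\psi(xz/\mu)=\psi(e_n)$ with $\psi(t)=t^{r/2}$.) Algorithm, with accuracy parameter $\epsilon>0$ and update parameter $0<\theta<1$: start with $(x,y,z)=(x^{(0)},y^{(0)},z^{(0)})$ and $\mu=\mu^{(0)}$. While $x^Tz>\epsilon$, do one iteration: set $\mu:=(1-\theta)\mu$; compute $(\Delta x,\Delta y,\Delta z)$ at the current $(x,y,z)$ with the current $\mu$; set $(x,y,z):=(x+\Delta x,y+\Delta y,z+\Delta z)$.
   Formalization: The algorithm is shown to stop with x^T z ≤ ε within the bound (0 if the bound is negative); ε-optimality for (P) and (D) is claimed only if A^T y+z=∇f(x) holds at the output, since Newton steps need not preserve this for non-quadratic f. *)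

(* Defs.v *)
From HB Require Import structures.
From mathcomp Require Import all_boot all_order all_algebra.
From mathcomp Require Import all_classical all_reals all_analysis.

Set Implicit Arguments.
Unset Strict Implicit.
Unset Printing Implicit Defensive.

Import Order.TTheory GRing.Theory Num.Theory.
Import numFieldNormedType.Exports.

Local Open Scope classical_set_scope.
Local Open Scope ring_scope.

Section Vectors.
Context {R : realType} {n : nat}.
Implicit Types u v : 'cV[R]_n.

Definition vmul u v : 'cV[R]_n := map2_mx *%R u v.

Definition inner u v : R := (u^T *m v) 0 0.

(* The norm `|v| that MathComp-Analysis puts on matrices is the sup norm. *)
Definition enorm v : R := Num.sqrt (inner v v).

Definition vpos v : Prop := forall i, 0 < v i 0.
Definition vnneg v : Prop := forall i, 0 <= v i 0.

End Vectors.

Section Derivatives.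
Context {R : realType} {n : nat}.
Implicit Types f : 'cV[R]_n -> R.

Definition grad f (x : 'cV[R]_n) : 'cV[R]_n := \col_i 'D_(delta_mx i 0) f x.

Definition hessian f (x : 'cV[R]_n) : 'M[R]_n :=
  \matrix_(i, j) 'D_(delta_mx j 0) (fun u => grad f u i 0) x.

(* Fréchet differentiability of f and of its gradient on the whole space. *)
Definition twice_differentiable f : Prop :=
  (forall x, differentiable f x) /\ (forall x, differentiable (grad f) x).

End Derivatives.

Section Problems.
Context {R : realType} {m n : nat}.
Variables (A : 'M[R]_(m, n)) (b : 'cV[R]_m) (f : 'cV[R]_n -> R).

Definition primal_feasible (x : 'cV[R]_n) : Prop := A *m x = b /\ vnneg x.

(* As in the dual problem itself, x carries no sign or equality constraint. *)
Definition dual_feasible (x : 'cV[R]_n) (y : 'cV[R]_m) (z : 'cV[R]_n) : Prop :=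
  A^T *m y + z = grad f x /\ vnneg z.

Definition dual_objective (x : 'cV[R]_n) (y : 'cV[R]_m) : R :=
  inner b y + f x - inner x (grad f x).

Definition strictly_feasible
    (x : 'cV[R]_n) (y : 'cV[R]_m) (z : 'cV[R]_n) : Prop :=
  [/\ A *m x = b, vpos x, A^T *m y + z = grad f x & vpos z].

Definition eps_optimal (eps : R)
    (x : 'cV[R]_n) (y : 'cV[R]_m) (z : 'cV[R]_n) : Prop :=
  [/\ primal_feasible x,
      dual_feasible x y z,
      (forall x', primal_feasible x' -> f x <= f x' + eps) &
      (forall x' y' z', dual_feasible x' y' z' ->
         dual_objective x' y' <= dual_objective x y + eps)].

End Problems.

Section Algorithm.
Context {R : realType} {m n : nat}.
Variables (r : nat) (A : 'M[R]_(m, n)) (f : 'cV[R]_n -> R).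

Definition wvec (x z : 'cV[R]_n) (mu : R) : 'cV[R]_n :=
  map_mx (fun t => Num.sqrt (t / mu)) (vmul x z).

Definition pvec (w : 'cV[R]_n) : 'cV[R]_n :=
  map_mx (fun t => (2 - 2 * t ^+ r) / (r%:R * t ^+ r.-1)) w.

Definition Gam (x z : 'cV[R]_n) (mu : R) : R := enorm (pvec (wvec x z mu)) / 2.

Definition newton_system (x z : 'cV[R]_n) (mu : R)
    (d : 'cV[R]_n * 'cV[R]_m * 'cV[R]_n) : Prop :=
  let: (dx, dy, dz) := d in
  [/\ A *m dx = 0,
      A^T *m dy + dz = hessian f x *m dx &
      vmul z dx + vmul x dz = mu *: vmul (wvec x z mu) (pvec (wvec x z mu))].

Record state := State {
  st_x : 'cV[R]_n; st_y : 'cV[R]_m; st_z : 'cV[R]_n; st_mu : R }.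

(* [unique] makes a step possible only if the Newton system has exactly one
   solution; the algorithm is therefore deterministic, and the existence of a
   terminating run includes that every search direction is well defined. *)
Definition iteration (theta : R) (s s' : state) : Prop :=
  let mu := (1 - theta) * st_mu s in
  exists dx dy dz,
    unique (newton_system (st_x s) (st_z s) mu) (dx, dy, dz) /\
    s' = State (st_x s + dx) (st_y s + dy) (st_z s + dz) mu.

(* [terminates eps theta s k t]: started in s, the while loop is exited in
   state t after exactly k iterations. *)
Inductive terminates (eps theta : R) : state -> nat -> state -> Prop :=
| terminates_stop s :
    inner (st_x s) (st_z s) <= eps -> terminates eps theta s 0 s
| terminates_step s s' k t :
    eps < inner (st_x s) (st_z s) -> iteration theta s s' ->
    terminates eps theta s' k t -> terminates eps theta s k.+1 t.

End Algorithm.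

(* Main.v *)
Require Import Defs.
From mathcomp Require Import all_boot all_order all_algebra.
From mathcomp Require Import all_classical all_reals all_analysis.
From mathcomp Require Import ring lra.
Import Order.TTheory GRing.Theory Num.Theory.
Import numFieldNormedType.Exports.
Local Open Scope classical_set_scope.
Local Open Scope ring_scope.

(** Writing w = sqrt(x z / mu), the right-hand side of the Newton system is
    such that the scaled displacements a = w dx / x and c = w dz / z satisfy
    a + c = p_w. With h = p_w / 2 and q = (a - c) / 2, the new complementarity
    products are, componentwise,

      (x + dx) (z + dz) / mu = (w + a) (w + c) = (w + h)^2 - q^2.

    Convexity enters only through dx^T dz >= 0, that is ||q|| <= ||h|| =
    Gamma: it holds because A dx = 0 and the Hessian is positive semidefinite
    ([hessian_psd], [newton_inner_ge0]). The same inequality makes the kernel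
    of the Newton matrix trivial, so that every direction is well defined
    ([newton_system_solvable]).

    The rest is about the function h(w) = (1 - w^r) / (r w^(r-1)). By
    Bernoulli's inequality w + h(w) >= 1 ([newton_point_ge1]), so that q^2 < 1
    keeps the iterate interior, and (w + h)^2 <= 1 + (r-1)^2 h^2
    ([newton_point_sqr_le_coarse]), so that the new w is within O(Gamma^2) of
    the vector of ones. Put E = e^(-r) and suppose Gamma <= E. Since
    theta sqrt(n) = E^2, decreasing mu to (1 - theta) mu raises Gamma to at
    most E (1 + 5 E / 4) ([halfstep_rescale_le]); the Newton step brings it
    back to 9 E / 10, and even to 3 E / 5 if r >= 2 ([scaled_step_prox]). Of
    the number e these estimates use only e >= 5/2.

    For the iteration count, the claim to prove is that the product x^T z
    after j iterations is at most mu0 (1 - theta/2)^(2j) N, with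
    N = n + (r-1)^2 E^2 ([scaled_step_gap]). Summing (w + h)^2 - q^2 over the
    components gives at most n + (r-1)^2 Gamma^2, but Gamma is here the
    proximity after the decrease of mu, which may exceed E. Three cases
    repair this.
    - If r = 1, the coefficient (r-1)^2 is zero.
    - If r >= 3, near w = 1 the coefficient (r-1)^2 can be lowered by nearly
      r - 2 ([newton_point_sqr_le]), which pays for the factor
      (1 + 5 E / 4)^2.
    - If r = 2, that gain vanishes. From the second iteration on, the previous
      step left Gamma <= 3 E / 5, hence Gamma <= E after the decrease of mu. In
      the first iteration the choice mu0 = x^T z / n means that the squares of
      w sum to n, and an exact computation gives the bound
      ([newton_points_sum_first]).
    Since (1 - theta/2)^2 <= e^(-theta), the stopping test holds as soon as
    theta j >= log (mu0 N / eps). At the final point, weak duality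
    ([weak_duality]) turns x^T z <= eps into eps-optimality. *)

Set Implicit Arguments.
Unset Strict Implicit.
Unset Printing Implicit Defensive.

(** * The scalar half-step *)

Section Scalar.
Context {R : realFieldType}.
Implicit Types (w h q v : R) (k r : nat).

Lemma bernoulli_lower w k : 0 <= w -> 1 + k%:R * (w - 1) <= w ^+ k.
Proof.
move=> w0; elim: k => [|k IH]; first by rewrite expr0 mul0r addr0.
rewrite exprS; apply: le_trans (ler_wpM2l w0 IH).
have k0 : 0 <= k%:R :> R by [].
have := mulr_ge0 k0 (sqr_ge0 (w - 1)); rewrite -natr1; nra.
Qed.

(** The tangent inequality of the power function taken at w instead of 1. *)
Lemma bernoulli_upper w k :
  0 <= w -> w ^+ k.+1 <= 1 + k.+1%:R * w ^+ k * (w - 1).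
Proof.
move=> w0; elim: k => [|k IH]; first by rewrite expr0 expr1; lra.
have mono : 0 <= (w ^+ k.+1 - 1) * (w - 1).
  have [w1|w1] := lerP 1 w; first by rewrite mulr_ge0 ?subr_ge0 ?exprn_ege1.
  by rewrite mulr_le0 ?subr_le0 ?exprn_ile1 // ltW.
rewrite exprS; apply: le_trans (ler_wpM2l w0 IH) _.
move: mono; rewrite -[k.+2%:R]natr1 !exprS; nra.
Qed.

(** Half a component of the vector p_w: a step with equal scaled displacements
    of x and z moves w to w + halfstep r w. Below, r is written k.+1, so that
    the exponent r.-1 is k. *)
Definition halfstep r w : R := (1 - w ^+ r) / (r%:R * w ^+ r.-1).

Lemma halfstepE k w : 0 < w ->
  k.+1%:R * w ^+ k * halfstep k.+1 w = 1 - w ^+ k.+1.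
Proof.
move=> w0; rewrite /halfstep /= mulrC divfK //.
by rewrite mulf_neq0 ?pnatr_eq0 ?expf_neq0 ?gt_eqF.
Qed.

Lemma newton_point_ge1 k w : 0 < w -> 1 <= w + halfstep k.+1 w.
Proof.
move=> w0; have c0 : 0 < k.+1%:R * w ^+ k by rewrite mulr_gt0 ?exprn_gt0.
rewrite -(ler_pM2l c0) mulrDr halfstepE // mulr1.
have := bernoulli_upper k (ltW w0); lra.
Qed.

(** A small half-step keeps w^(r-1) away from zero: if w <= 1 then
    w^(r-1) >= w^r = 1 - r h w^(r-1). *)
Lemma expr_ge_halfstep k w : 0 < w ->
  1 - k.+1%:R * `|halfstep k.+1 w| <= w ^+ k.
Proof.
move=> w0; have y0 : 0 < w ^+ k by rewrite exprn_gt0.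
have r0 : 0 < k.+1%:R :> R by [].
have [w1|w1] := lerP 1 w.
  apply: (@le_trans _ _ 1); last by rewrite exprn_ege1.
  by rewrite gerBl mulr_ge0.
have y1 : w ^+ k <= 1 by rewrite exprn_ile1 // ltW.
have E := halfstepE k w0; move: E; rewrite exprS => E.
have h0 := normr_ge0 (halfstep k.+1 w).
have h1 := ler_norm (halfstep k.+1 w).
set y := w ^+ k in y0 y1 E *; set a := `|_| in h0 h1 *.
have : k.+1%:R * y * halfstep k.+1 w <= k.+1%:R * y * a.
  by rewrite ler_wpM2l // ltW ?mulr_gt0.
have : k.+1%:R * a * y <= k.+1%:R * a by rewrite ler_piMr // mulr_ge0 // ltW.
have : w * y <= y by rewrite ler_piMl // ltW.
lra.
Qed.

(** The mirror bound for w >= 1, where r |h| = w - w^(1-r). *)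
Lemma exprV_ge_halfstep k w : 0 < w ->
  1 - k.+1%:R * `|halfstep k.+1 w| <= (w ^+ k)^-1.
Proof.
move=> w0; have y0 : 0 < w ^+ k by rewrite exprn_gt0.
have r0 : 0 < k.+1%:R :> R by [].
have [w1|w1] := lerP w 1.
  apply: (@le_trans _ _ 1); first by rewrite gerBl mulr_ge0.
  by rewrite invf_ge1 // exprn_ile1 // ltW.
have E : k.+1%:R * - halfstep k.+1 w = w - (w ^+ k)^-1.
  apply: (mulfI (lt0r_neq0 y0)); rewrite mulrBr divff ?lt0r_neq0 //.
  by have := halfstepE k w0; rewrite exprS; lra.
have h1 : - halfstep k.+1 w <= `|halfstep k.+1 w| by rewrite -normrN ler_norm.
have := ler_wpM2l (ltW r0) h1; rewrite E; lra.
Qed.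

(** With F = r w^(2r-2) - 2 (r-1) w^r + (r-2) and h = halfstep r w,
      r^2 w^(2r-2) ((r-1)^2 h^2 + 1 - (w+h)^2) = r F,
    and two Bernoulli inequalities give F >= r (r-2) w^(r-1) (w-1)^2. Dropping
    F gives the coefficient (r-1)^2; keeping it saves (r-2) c, where c tends
    to 1 as w does. This saving is what the case r >= 3 needs. *)
Lemma newton_point_sqr_le k w (c := 1 - k.+2%:R * `|halfstep k.+2 w|) :
  0 < w ->
  (w + halfstep k.+2 w) ^+ 2 <=
    1 + ((k.+1%:R) ^+ 2 - k%:R * c) * halfstep k.+2 w ^+ 2.
Proof.
move=> w0.
have E := halfstepE k.+1 w0.
have cy : c <= w ^+ k.+1 := expr_ge_halfstep k.+1 w0.
have cV : c <= (w ^+ k.+1)^-1 := exprV_ge_halfstep k.+1 w0.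
set h := halfstep _ _ in E *; set y := w ^+ k.+1 in E cy cV *.
have y0 : 0 < y by rewrite exprn_gt0.
have B1 := bernoulli_lower k (ltW w0).
have B2 := bernoulli_upper k.+1 (ltW w0).
have B3 := bernoulli_lower k.+2 (ltW w0).
have wr : w ^+ k.+2 = w * y by rewrite exprS.
have yk : y = w * w ^+ k by rewrite /y exprS.
rewrite wr -/y in B2 B3 E.
have r0 : 0 < k.+2%:R * y :> R by rewrite mulr_gt0.
(* converts the factor (w - 1)^2 of the lower bound on F into h^2 *)
have key : c * (1 - w * y) ^+ 2 <= y * (k.+2%:R * (w - 1)) ^+ 2.
  have [w1|w1] := lerP w 1.
    have sq : (1 - w * y) ^+ 2 <= (k.+2%:R * (w - 1)) ^+ 2.
      rewrite -[leRHS]sqrrN ler_sqr ?nnegrE; first by lra.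
        by rewrite subr_ge0 mulr_ile1 ?exprn_ile1 ?(ltW w0) ?(ltW y0).
      by rewrite -mulrN mulr_ge0 // oppr_ge0 subr_le0.
    apply: le_trans (ler_wpM2r (sqr_ge0 _) cy) _.
    by rewrite ler_wpM2l // ltW.
  have sq : (1 - w * y) ^+ 2 <= (k.+2%:R * y * (w - 1)) ^+ 2.
    rewrite -[leLHS]sqrrN ler_sqr ?nnegrE; first by lra.
      by rewrite oppr_ge0 subr_le0 mulr_ege1 ?exprn_ege1 ?(ltW w1).
    by rewrite (mulr_ge0 (ltW r0)) ?subr_ge0 ?(ltW w1).
  apply: le_trans (ler_wpM2r (sqr_ge0 _) cV) _.
  have yV : 0 <= y^-1 by rewrite invr_ge0 ltW.
  apply: le_trans (ler_wpM2l yV sq) _.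
  suff -> : y^-1 * (k.+2%:R * y * (w - 1)) ^+ 2 = y * (k.+2%:R * (w - 1)) ^+ 2 by [].
  by field; rewrite gt_eqF.
have r20 : 0 < (k.+2%:R * y) ^+ 2 by rewrite exprn_gt0.
rewrite -(ler_pM2l r20).
have -> : (k.+2%:R * y) ^+ 2 * (w + h) ^+ 2 = (k.+2%:R * y * w + (1 - w * y)) ^+ 2.
  by rewrite -E; ring.
rewrite mulrDr mulr1.
have -> : (k.+2%:R * y) ^+ 2 * ((k.+1%:R ^+ 2 - k%:R * c) * h ^+ 2) =
  k.+1%:R ^+ 2 * (1 - w * y) ^+ 2 - k%:R * (c * (1 - w * y) ^+ 2) by rewrite -E; ring.
have k0 : 0 <= k%:R :> R by [].
have K1 := ler_wpM2l k0 key.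
(* the lower bound on F, with y = w^(r-1) *)
have F : k.+2%:R * k%:R * y * (w - 1) ^+ 2 <=
   k.+2%:R * y ^+ 2 - 2 * k.+1%:R * w * y + k%:R.
  have P1 : k.+2%:R * w * y * (1 + k%:R * (w - 1)) <= k.+2%:R * y * y.
    have := ler_wpM2l (mulr_ge0 (ltW r0) (ltW w0)) B1.
    by rewrite -[X in _ <= X]mulrA -yk [_ * y * w]mulrAC.
  have P2 := ler_wpM2l k0 B2.
  move: P1 P2; rewrite -[k.+2%:R]natr1 -[k.+1%:R]natr1.
  lra.
have := ler_wpM2l (ler0n R k.+2) F.
move: K1; rewrite -[k.+2%:R]natr1 -[k.+1%:R]natr1.
lra.
Qed.

(** For r = 1 the left-hand side is 1; for r >= 2 the saved term of
    [newton_point_sqr_le] is nonnegative. *)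
Lemma newton_point_sqr_le_coarse k (w : R) : 0 < w ->
  k.+1%:R * `|halfstep k.+1 w| <= 1 ->
  (w + halfstep k.+1 w) ^+ 2 <= 1 + k%:R ^+ 2 * halfstep k.+1 w ^+ 2.
Proof.
case: k => [|k] w0 rh.
  have -> : w + halfstep 1 w = 1 by rewrite /halfstep /= expr0; field.
  by rewrite expr1n lerDl mulr_ge0 ?sqr_ge0.
apply: le_trans (newton_point_sqr_le k w0) _.
rewrite lerD2l ler_wpM2r ?sqr_ge0 // gerBl mulr_ge0 // subr_ge0 //.
Qed.

(** Bounds the half-step by information on v^2, which is what a Newton step
    controls. For v >= 1, |h| <= v - 1 <= (v^2 - 1) / 2. For v < 1,
    |h| <= (1 - v) / v^(r-1), and r b <= 1 ensures r v^(r-1) >= 1. *)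
Lemma halfstep_norm_le k v a b :
  0 < v -> v ^+ 2 - 1 <= a -> 1 - v ^+ 2 <= b -> 0 <= a -> 0 <= b ->
  k.+1%:R * b <= 1 -> `|halfstep k.+1 v| <= a / 2 + k.+1%:R * b.
Proof.
move=> v0 va vb a0 b0 rb.
have y0 : 0 < v ^+ k by rewrite exprn_gt0.
have r0 : 0 < k.+1%:R :> R by [].
have c0 : 0 < k.+1%:R * v ^+ k by rewrite mulr_gt0.
have rb0 : 0 <= k.+1%:R * b by rewrite mulr_ge0 // ltW.
rewrite -(ler_pM2l c0) -{1}(gtr0_norm c0) -normrM halfstepE //.
have [v1|v1] := lerP 1 v.
  have -> : `|1 - v ^+ k.+1| = v ^+ k.+1 - 1.
    by rewrite distrC ger0_norm // subr_ge0 exprn_ege1.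
  have B := bernoulli_upper k (ltW v0).
  have : v - 1 <= a / 2 + k.+1%:R * b by nra.
  move=> /(ler_wpM2l (ltW c0)); lra.
have -> : `|1 - v ^+ k.+1| = 1 - v ^+ k.+1.
  by rewrite ger0_norm // subr_ge0 exprn_ile1 // ltW.
have B := bernoulli_lower k.+1 (ltW v0).
have B' := bernoulli_lower k (ltW v0).
have vb' : 1 - v <= b by nra.
have ry1 : 1 <= k.+1%:R * v ^+ k.
  have k0 : 0 <= k%:R :> R by [].
  have K1 := ler_wpM2l k0 vb'.
  have K2 := ler_wpM2l k0 rb.
  have := ler_wpM2l (ltW r0) B'; have := ler_wpM2l (ltW r0) K1.
  move: K2; rewrite -natr1; lra.
have := ler_wpM2l rb0 ry1.
have := ler_wpM2l (ltW r0) vb'.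
have : 0 <= k.+1%:R * v ^+ k * (a / 2) by rewrite mulr_ge0 ?(ltW c0) // divr_ge0.
lra.
Qed.

(** Dividing mu by 1/s^2 divides w by s; up to the factor s, the half-step
    changes by a term of order 1 - s^r. *)
Lemma halfstep_rescale k s w : 0 < s -> 0 < w ->
  s * halfstep k.+1 (w / s) =
    halfstep k.+1 w - (1 - s ^+ k.+1) / (k.+1%:R * w ^+ k).
Proof.
move=> s0 w0; have sn0 := lt0r_neq0 s0; have wn0 := lt0r_neq0 w0.
have rn0 : k.+1%:R != 0 :> R by rewrite pnatr_eq0.
rewrite /halfstep /= !expr_div_n !exprS.
by field; rewrite addrC natr1 rn0 sn0 !expf_neq0.
Qed.

End Scalar.

(** * Sums of squares *)

Section SumsOfSquares.
Context {R : realFieldType}.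

Lemma le_sum (I : finType) (F : I -> R) i :
  (forall j, 0 <= F j) -> F i <= \sum_j F j.
Proof. by move=> F0; rewrite (bigD1 i) //= lerDl sumr_ge0. Qed.

(** Minkowski's inequality for squares: weight Young's inequality
    2 a b <= (B/A) a^2 + (A/B) b^2 by the bounds themselves. *)
Lemma sum_sqr_triangle (I : finType) (a b : I -> R) A B : 0 < A -> 0 < B ->
  \sum_i a i ^+ 2 <= A ^+ 2 -> \sum_i b i ^+ 2 <= B ^+ 2 ->
  \sum_i (a i - b i) ^+ 2 <= (A + B) ^+ 2.
Proof.
move=> A0 B0 hA hB.
have An0 := lt0r_neq0 A0; have Bn0 := lt0r_neq0 B0.
apply: (@le_trans _ _ ((1 + B / A) * \sum_i a i ^+ 2 +
                       (1 + A / B) * \sum_i b i ^+ 2)).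
  rewrite !mulr_sumr -big_split /=; apply: ler_sum => i _.
  rewrite -subr_ge0.
  have -> : (1 + B / A) * a i ^+ 2 + (1 + A / B) * b i ^+ 2 - (a i - b i) ^+ 2
     = (B * a i + A * b i) ^+ 2 / (A * B) by field; rewrite An0 Bn0.
  by rewrite divr_ge0 ?sqr_ge0 ?mulr_ge0 ?(ltW A0) ?(ltW B0).
have c1 : 0 <= 1 + B / A by rewrite addr_ge0 ?divr_ge0 ?(ltW A0) ?(ltW B0).
have c2 : 0 <= 1 + A / B by rewrite addr_ge0 ?divr_ge0 ?(ltW A0) ?(ltW B0).
apply: le_trans (lerD (ler_wpM2l c1 hA) (ler_wpM2l c2 hB)) _.
by rewrite le_eqVlt; apply/orP; left; apply/eqP; field; rewrite An0 Bn0.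
Qed.

Lemma sqr_le_sum_sqr (I : finType) (a : I -> R) i :
  a i ^+ 2 <= \sum_j a j ^+ 2.
Proof. by apply: (le_sum (F := fun j => a j ^+ 2)) => j; rewrite sqr_ge0. Qed.

Lemma sum_sqr_le_sqr_sum (I : finType) (a b : I -> R) :
  (forall i, `|a i| <= b i) -> \sum_i a i ^+ 2 <= (\sum_i b i) ^+ 2.
Proof.
move=> ab; have b0 i : 0 <= b i := le_trans (normr_ge0 _) (ab i).
rewrite expr2 mulr_suml; apply: ler_sum => i _.
rewrite -real_normK ?num_real // expr2 ler_pM ?normr_ge0 //.
by rewrite (le_trans (ab i)) // (bigD1 i) //= lerDl sumr_ge0.
Qed.

Lemma norm_le_sum_sqr (I : finType) (a : I -> R) G i : 0 <= G ->
  \sum_j a j ^+ 2 <= G ^+ 2 -> `|a i| <= G.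
Proof.
move=> G0 /(le_trans (sqr_le_sum_sqr a i)).
by rewrite -real_normK ?num_real // ler_sqr ?nnegrE.
Qed.

End SumsOfSquares.

(** * One iteration in scaled coordinates *)

Section Proximity.
Context {R : realFieldType}.

(** A polynomial substitute for s >= sqrt (1 - E^2); the coefficient must
    exceed 1/2, and E <= 2/5 leaves room for 11/20. *)
Lemma sqr_deficit_lower (s E : R) : 0 < s -> 0 <= E -> E <= 2 / 5 ->
  1 - s ^+ 2 <= E ^+ 2 -> 1 - 11 / 20 * E ^+ 2 <= s.
Proof.
move=> s0 E0 E25 sE.
have u0 : 0 <= E ^+ 2 by rewrite sqr_ge0.
have u1 : E ^+ 2 <= 4 / 25 by nra.
rewrite -ler_sqr ?nnegrE ?(ltW s0) //; last by lra.
by nra.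
Qed.

(** The effect of the decrease of mu on the proximity. The shift of each
    component is (1 - s^r) / (r w^(r-1)) <= (1 - s) / w^(r-1), where
    1 - s = (1 - s^2) / (1 + s) and w^(r-1) >= 1 - r E >= 3/5; as s >= 91/100,
    this is at most 7/8 of 1 - s^2, whose Euclidean norm over n components is
    at most E^2. *)
Lemma halfstep_rescale_sum k n (w : 'I_n -> R) s E A :
  (forall i, 0 < w i) -> 0 < s -> s <= 1 ->
  E <= 2 / 5 -> k.+1%:R * E <= 2 / 5 -> 0 < A -> A <= E ->
  1 - s ^+ 2 <= E ^+ 2 -> n%:R * (1 - s ^+ 2) ^+ 2 <= E ^+ 4 ->
  \sum_i halfstep k.+1 (w i) ^+ 2 <= A ^+ 2 ->
  s ^+ 2 * \sum_i halfstep k.+1 (w i / s) ^+ 2 <= (A + 7 / 8 * E ^+ 2) ^+ 2.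
Proof.
move=> w0 s0 s1 E25 rE A0 AE sE nE hA.
have E0 : 0 < E := lt_le_trans A0 AE.
rewrite mulr_sumr.
under eq_bigr do rewrite -exprMn halfstep_rescale //.
apply: sum_sqr_triangle => //; first by rewrite mulr_gt0 ?exprn_gt0 ?divr_gt0.
set th := 1 - s ^+ 2 in sE nE *.
have slo := sqr_deficit_lower s0 (ltW E0) E25 sE.
apply: (@le_trans _ _ (\sum_(i < n) (7 / 8 * th) ^+ 2)); last first.
  rewrite sumr_const card_ord -[_ *+ n]mulr_natl; lra.
apply: ler_sum => i _.
have th0 : 0 <= th by rewrite /th; nra.
have hi : `|halfstep k.+1 (w i)| <= E.
  apply: le_trans AE.
  exact: (norm_le_sum_sqr (a := fun j => halfstep k.+1 (w j)) i (ltW A0)).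
have r0 : 0 < k.+1%:R :> R by [].
have y35 : 3 / 5 <= w i ^+ k.
  have := expr_ge_halfstep k (w0 i); have := ler_wpM2l (ltW r0) hi; lra.
have c0 : 0 < k.+1%:R * w i ^+ k by rewrite mulr_gt0 // exprn_gt0.
have B := bernoulli_lower k.+1 (ltW s0).
have num0 : 0 <= 1 - s ^+ k.+1 by rewrite subr_ge0 exprn_ile1 // ltW.
rewrite ler_sqr ?nnegrE ?divr_ge0 ?(ltW c0) ?mulr_ge0 ?invr_ge0 //.
rewrite ler_pdivrMr //.
have P : 1 - s <= 7 / 8 * th * (3 / 5).
  have : 91 / 100 <= s by nra.
  by rewrite /th; nra.
have Q : 7 / 8 * th * (3 / 5) <= 7 / 8 * th * w i ^+ k.
  by rewrite ler_wpM2l // mulr_ge0 // divr_ge0.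
have := ler_wpM2l (ltW r0) (le_trans P Q); lra.
Qed.

(** The factor 5/4 absorbs both the shift 7/8 and the division by s. *)
Lemma halfstep_rescale_le k n (w : 'I_n -> R) s E :
  (forall i, 0 < w i) -> 0 < s -> s <= 1 -> 0 < E ->
  E <= 2 / 5 -> k.+1%:R * E <= 2 / 5 ->
  1 - s ^+ 2 <= E ^+ 2 -> n%:R * (1 - s ^+ 2) ^+ 2 <= E ^+ 4 ->
  \sum_i halfstep k.+1 (w i) ^+ 2 <= E ^+ 2 ->
  \sum_i halfstep k.+1 (w i / s) ^+ 2 <= (E * (1 + 5 / 4 * E)) ^+ 2.
Proof.
move=> w0 s0 s1 E0 E25 rE sE nE hE.
have := halfstep_rescale_sum w0 s0 s1 E25 rE E0 (lexx E) sE nE hE.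
have slo := sqr_deficit_lower s0 (ltW E0) E25 sE.
have s20 : 0 < s ^+ 2 by rewrite exprn_gt0.
rewrite -(ler_pM2l s20 _ ((E * (1 + 5 / 4 * E)) ^+ 2)) => /le_trans; apply.
rewrite -exprMn ler_sqr ?nnegrE; [|nra|nra].
have : (1 - 11 / 20 * E ^+ 2) * (1 + 5 / 4 * E) <= s * (1 + 5 / 4 * E).
  by rewrite ler_wpM2r //; lra.
have : 0 <= E * (3 / 8 - 11 / 20 * E - 11 / 16 * E ^+ 2).
  by rewrite mulr_ge0 ?(ltW E0) //; nra.
move=> ? ?; have : 1 + 7 / 8 * E <= s * (1 + 5 / 4 * E) by lra.
move=> /(ler_wpM2l (ltW E0)); lra.
Qed.

(** A point with proximity 3 E / 5 has room for the whole shift. *)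
Lemma halfstep_rescale_le_centered k n (w : 'I_n -> R) s E :
  (forall i, 0 < w i) -> 0 < s -> s <= 1 -> 0 < E ->
  E <= 4 / 25 -> k.+1%:R * E <= 2 / 5 ->
  1 - s ^+ 2 <= E ^+ 2 -> n%:R * (1 - s ^+ 2) ^+ 2 <= E ^+ 4 ->
  \sum_i halfstep k.+1 (w i) ^+ 2 <= (3 / 5 * E) ^+ 2 ->
  \sum_i halfstep k.+1 (w i / s) ^+ 2 <= E ^+ 2.
Proof.
move=> w0 s0 s1 E0 E25 rE sE nE hE.
have E25' : E <= 2 / 5 by lra.
have A0 : 0 < 3 / 5 * E by lra.
have AE : 3 / 5 * E <= E by lra.
have := halfstep_rescale_sum w0 s0 s1 E25' rE A0 AE sE nE hE.
have slo := sqr_deficit_lower s0 (ltW E0) E25' sE.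
have s20 : 0 < s ^+ 2 by rewrite exprn_gt0.
rewrite -(ler_pM2l s20 _ (E ^+ 2)) => /le_trans; apply.
rewrite -exprMn ler_sqr ?nnegrE; [|nra|nra].
have : 9 / 10 <= s by nra.
nra.
Qed.

(** Plays the part of 1 + k + k^2/2 <= e^k: it says that Gamma^2 of order E^2,
    multiplied by the quadratic constant of one step, is still of order E. *)
Lemma radius_quadratic k (E : R) : E <= (2 / 5) ^+ k.+1 ->
  E * (k%:R ^+ 2 / 2 + k.+1%:R) <= 2 / 5.
Proof.
have q0 j : 0 <= j%:R ^+ 2 / 2 + j.+1%:R :> R.
  by rewrite addr_ge0 // divr_ge0 ?sqr_ge0.
move=> /(ler_wpM2r (q0 k)) /le_trans; apply.
elim: k => [|k IH]; first by rewrite expr1; lra.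
have p0 : 0 <= (2 / 5) ^+ k.+1 :> R by rewrite exprn_ge0 // divr_ge0.
have k0 : 0 <= k%:R :> R by [].
rewrite exprS; apply: le_trans _ IH.
have := mulr_ge0 p0 (addr_ge0 (sqr_ge0 k%:R) k0).
have := mulr_ge0 p0 (sqr_ge0 k%:R).
rewrite -[k.+2%:R]natr1 -[k.+1%:R]natr1; lra.
Qed.

Lemma radius_linear k (E : R) : E <= (2 / 5) ^+ k.+3 ->
  k.+3%:R * E <= 24 / 125 /\ k.+2%:R * E <= 16 / 125.
Proof.
suff [H1 H2] : k.+3%:R * (2 / 5) ^+ k.+3 <= 24 / 125 :> R /\
               k.+2%:R * (2 / 5) ^+ k.+3 <= 16 / 125 :> R.
  by move=> Ek; split; [apply: le_trans _ H1|apply: le_trans _ H2];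
    rewrite ler_wpM2l.
elim: k => [|k [IH1 IH2]]; first by split; lra.
have p0 : 0 <= (2 / 5) ^+ k.+3 :> R by rewrite exprn_ge0 // divr_ge0.
have kp0 : 0 <= k%:R * (2 / 5) ^+ k.+3 :> R by rewrite mulr_ge0.
move: IH1 IH2; rewrite [_ ^+ k.+4]exprS.
rewrite -[k.+4%:R]natr1 -[k.+3%:R]natr1 -[k.+2%:R]natr1 -[k.+1%:R]natr1.
by split; lra.
Qed.

(** The equality (w + a)(w + c) = (w + h)^2 - ((a - c)/2)^2, where the last
    square is written h^2 - a c so that its sum can be compared with that of
    h^2 through the sign of the inner product of a and c. *)
Lemma step_sqr (w a c h : R) : a + c = 2 * h ->
  (w + a) * (w + c) = (w + h) ^+ 2 - (h ^+ 2 - a * c).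
Proof.
move=> ac; have -> : c = 2 * h - a by lra.
ring.
Qed.

Lemma step_defect (I : finType) (a c h : I -> R) :
  (forall i, a i + c i = 2 * h i) -> 0 <= \sum_i a i * c i ->
  (forall i, 0 <= h i ^+ 2 - a i * c i) /\
  \sum_i (h i ^+ 2 - a i * c i) <= \sum_i h i ^+ 2.
Proof.
move=> ac ac0; split=> [i|]; last by rewrite sumrB gerBl.
have -> : h i ^+ 2 - a i * c i = ((a i - c i) / 2) ^+ 2.
  by rewrite (_ : h i = (a i + c i) / 2); [field | rewrite ac; field].
by rewrite sqr_ge0.
Qed.

(** Quadratic convergence: v^2 - 1 is at most (r-1)^2 h^2 and 1 - v^2 at most
    q^2, and both have sums bounded by multiples of G^2. The Euclidean norm of
    the new half-steps is bounded by the sum of their absolute values. *)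
Lemma halfstep_sum_after_step k n (w a c v : 'I_n -> R) G :
  (forall i, 0 < w i) -> (forall i, 0 < v i) ->
  (forall i, a i + c i = 2 * halfstep k.+1 (w i)) ->
  0 <= \sum_i a i * c i ->
  (forall i, v i ^+ 2 = (w i + a i) * (w i + c i)) ->
  0 <= G -> k.+1%:R * G <= 1 ->
  \sum_i halfstep k.+1 (w i) ^+ 2 <= G ^+ 2 ->
  \sum_i halfstep k.+1 (v i) ^+ 2 <=
    (G ^+ 2 * (k%:R ^+ 2 / 2 + k.+1%:R)) ^+ 2.
Proof.
move=> w0 v0 ach ac0 vE G0 rG hG.
pose h i := halfstep k.+1 (w i).
pose q2 i := h i ^+ 2 - a i * c i.
have [d1 d2] := step_defect (h := h) ach ac0.
have q20 i : 0 <= q2 i := d1 i.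
have q2G : \sum_i q2 i <= G ^+ 2 := le_trans d2 hG.
have r1 : 1 <= k.+1%:R :> R by rewrite ler1n.
have r0 : 0 <= k.+1%:R :> R by [].
have hiG i : `|h i| <= G := norm_le_sum_sqr i G0 hG.
have pw i : `|halfstep k.+1 (v i)| <= k%:R ^+ 2 * h i ^+ 2 / 2 + k.+1%:R * q2 i.
  have rh : k.+1%:R * `|h i| <= 1 by apply: le_trans (ler_wpM2l r0 (hiG i)) rG.
  have t1 := newton_point_ge1 k (w0 i).
  have t2 := newton_point_sqr_le_coarse (w0 i) rh.
  rewrite -/(h i) in t1 t2.
  have vE' : v i ^+ 2 = (w i + h i) ^+ 2 - q2 i.
    by rewrite vE (step_sqr (w i) (ach i)).
  apply: halfstep_norm_le => //.
  - by rewrite vE'; have := q20 i; lra.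
  - by rewrite vE'; nra.
  - by rewrite mulr_ge0 ?sqr_ge0.
  have : q2 i <= G ^+ 2 := le_trans (le_sum i q20) q2G.
  move=> /(ler_wpM2l r0) /le_trans; apply.
  have G1 : G <= 1 by nra.
  by rewrite expr2 mulrA; apply: mulr_ile1 => //; rewrite mulr_ge0.
apply: le_trans (sum_sqr_le_sqr_sum pw) _.
rewrite ler_sqr ?nnegrE.
- rewrite big_split /= -mulr_suml -!mulr_sumr.
  have k20 : 0 <= k%:R ^+ 2 :> R by rewrite sqr_ge0.
  have := ler_wpM2l k20 hG; have := ler_wpM2l r0 q2G.
  lra.
- apply: sumr_ge0 => i _; exact: le_trans (normr_ge0 _) (pw i).
- by rewrite mulr_ge0 ?sqr_ge0 // addr_ge0 // divr_ge0 ?sqr_ge0.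
Qed.

Lemma newton_points_sum_le k n (w : 'I_n -> R) E :
  (forall i, 0 < w i) -> 0 <= E -> k.+1%:R * E <= 1 ->
  \sum_i halfstep k.+1 (w i) ^+ 2 <= E ^+ 2 ->
  \sum_i (w i + halfstep k.+1 (w i)) ^+ 2 <= n%:R + k%:R ^+ 2 * E ^+ 2.
Proof.
move=> w0 E0 rE hE.
apply: (@le_trans _ _ (\sum_i (1 + k%:R ^+ 2 * halfstep k.+1 (w i) ^+ 2))).
  apply: ler_sum => i _; apply: newton_point_sqr_le_coarse => //.
  apply: le_trans rE; rewrite ler_wpM2l //.
  exact: (norm_le_sum_sqr (a := fun i => halfstep k.+1 (w i))).
rewrite big_split /= sumr_const card_ord lerD2l -mulr_sumr.
by rewrite ler_wpM2l // sqr_ge0.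
Qed.

(** The case r >= 3 after the decrease of mu. With rate
    (r-1)^2 - 79/100 (r-2) per component, the factor (1 + 5 E / 4)^2, at most
    1 + 26/10 E, is absorbed because (r-1)^2 E <= 16/125 (r-1), while
    r - 1 <= 2 (r - 2). *)
Lemma newton_points_sum_le_large k n (w : 'I_n -> R) E :
  (forall i, 0 < w i) -> 0 <= E -> E <= 8 / 125 ->
  k.+3%:R * E <= 24 / 125 -> k.+2%:R * E <= 16 / 125 ->
  \sum_i halfstep k.+3 (w i) ^+ 2 <= (E * (1 + 5 / 4 * E)) ^+ 2 ->
  \sum_i (w i + halfstep k.+3 (w i)) ^+ 2 <= n%:R + k.+2%:R ^+ 2 * E ^+ 2.
Proof.
move=> w0 E0 E1 rE kE hG.
set G := E * _ in hG.
have GE : G <= 27 / 25 * E by rewrite /G; nra.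
have G0 : 0 <= G by rewrite /G; nra.
have r0 : 0 <= k.+3%:R :> R by [].
have k0 : 0 <= k%:R :> R by [].
pose C : R := k.+2%:R ^+ 2 - k.+1%:R * (79 / 100).
apply: (@le_trans _ _ (\sum_i (1 + C * halfstep k.+3 (w i) ^+ 2))).
  apply: ler_sum => i _; apply: le_trans (newton_point_sqr_le k.+1 (w0 i)) _.
  rewrite lerD2l ler_wpM2r ?sqr_ge0 // lerD2l lerN2 ler_wpM2l //.
  have := norm_le_sum_sqr (a := fun i => halfstep k.+3 (w i)) i G0 hG.
  move=> /le_trans /(_ GE) /(ler_wpM2l r0); lra.
rewrite big_split /= sumr_const card_ord lerD2l -mulr_sumr.
have C0 : 0 <= C by rewrite /C -[k.+2%:R]natr1 -[k.+1%:R]natr1; nra.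
apply: le_trans (ler_wpM2l C0 hG) _.
rewrite /G exprMn [E ^+ 2 * _]mulrC mulrA ler_wpM2r ?sqr_ge0 //.
have sq : (1 + 5 / 4 * E) ^+ 2 <= 1 + 26 / 10 * E by nra.
apply: le_trans (ler_wpM2l C0 sq) _.
have : k.+2%:R ^+ 2 * E <= 16 / 125 * k.+2%:R by rewrite expr2 -mulrA mulrC ler_wpM2r.
have : 0 <= k.+1%:R * E by rewrite mulr_ge0.
rewrite /C -[k.+2%:R]natr1 -[k.+1%:R]natr1; nra.
Qed.

(** The case r = 2 at a point whose duality gap is exactly n mu: there
    s (w/s + h (w/s)) = (w + s^2/w) / 2, and both sides are combinations of the
    sums of w^2 and of 1/w^2. *)
Lemma newton_points_sum_first n (w : 'I_n -> R) s :
  (forall i, 0 < w i) -> 0 < s -> \sum_i w i ^+ 2 = n%:R ->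
  s ^+ 2 * \sum_i (w i / s + halfstep 2 (w i / s)) ^+ 2 =
    n%:R * ((1 + s ^+ 2) / 2) ^+ 2 + s ^+ 4 * \sum_i halfstep 2 (w i) ^+ 2.
Proof.
move=> w0 s0 wn.
rewrite !mulr_sumr.
have -> : n%:R * ((1 + s ^+ 2) / 2) ^+ 2 =
   \sum_i ((1 - s ^+ 4) / 4 * w i ^+ 2 + (s ^+ 2 + s ^+ 4) / 2).
  by rewrite big_split /= -mulr_sumr wn sumr_const card_ord -mulr_natl; field.
rewrite -big_split /=; apply: eq_bigr => i _.
by rewrite /halfstep /=; field; rewrite !lt0r_neq0.
Qed.

Lemma pos_pair (u v : R) : 0 < u * v -> 0 < u + v -> 0 < u /\ 0 < v.
Proof. by move=> uv0 uv1; split; nra. Qed.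

Section ScaledStep.
Variables (k n : nat) (w a c : 'I_n -> R) (s E : R).
Local Notation h := (halfstep k.+1).
Hypothesis w_gt0 : forall i, 0 < w i.
Hypothesis s_gt0 : 0 < s.
Hypothesis s_le1 : s <= 1.
Hypothesis E_gt0 : 0 < E.
Hypothesis E_le : E <= (2 / 5) ^+ k.+1.
(* s^2 = 1 - theta, where theta <= E^2 and sqrt n * theta <= E^2 *)
Hypothesis deficit : 1 - s ^+ 2 <= E ^+ 2.
Hypothesis deficit_sum : n%:R * (1 - s ^+ 2) ^+ 2 <= E ^+ 4.
Hypothesis prox : \sum_i h (w i) ^+ 2 <= E ^+ 2.
Hypothesis dir_sum : forall i, a i + c i = 2 * h (w i / s).
Hypothesis dir_inner : 0 <= \sum_i a i * c i.

(* the proximity after the decrease of mu *)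
Let G : R := E * (1 + 5 / 4 * E).

Let W_gt0 i : 0 < w i / s.
Proof. by rewrite divr_gt0. Qed.

Let E_ge0 : 0 <= E. Proof. exact: ltW. Qed.

Let rE : k.+1%:R * E <= 2 / 5.
Proof.
have := radius_quadratic E_le; have : 0 <= E * (k%:R ^+ 2 / 2).
  by rewrite mulr_ge0 // divr_ge0 ?sqr_ge0.
lra.
Qed.

Let E25 : E <= 2 / 5.
Proof. by apply: le_trans rE; rewrite ler_peMl // ler1n. Qed.

Let G_le : G <= 3 / 2 * E.
Proof. by rewrite /G; move: E_ge0 E25; nra. Qed.
Let G_ge0 : 0 <= G.
Proof. by rewrite /G; move: E_ge0; nra. Qed.

Let rG : k.+1%:R * G <= 1.
Proof. by have := ler_wpM2l (ler0n R k.+1) G_le; move: rE; lra. Qed.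

Let proxW : \sum_i h (w i / s) ^+ 2 <= G ^+ 2.
Proof. exact: halfstep_rescale_le. Qed.

Let exp_le j : (j <= k)%N -> E <= (2 / 5) ^+ j.+1.
Proof. by move=> jk; apply: le_trans E_le _; rewrite ler_wiXn2l //; lra. Qed.

(** The product of the two factors exceeds 1 - G^2 > 0, and their sum is
    2 (w + h) > 0: they cannot both be negative. *)
Lemma scaled_step_gt0 i : 0 < w i / s + a i /\ 0 < w i / s + c i.
Proof.
have [q0 /le_trans /(_ proxW) qG] := step_defect dir_sum dir_inner.
have qi := le_trans (le_sum i q0) qG.
have t1 := newton_point_ge1 k (W_gt0 i).
apply: pos_pair; last by have := dir_sum i; move: t1; lra.
rewrite (step_sqr (w i / s) (dir_sum i)) subr_gt0.
have G35 : G <= 3 / 5 by move: G_le E25; lra.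
apply: (le_lt_trans qi); move: G_ge0 G35 t1; nra.
Qed.

(** The bound G^2 (k^2/2 + k + 1) is at most (2/5) (1 + 5 E / 4)^2 E, and
    E <= 2/5, or E <= 4/25 when r >= 2. *)
Lemma scaled_step_prox (v : 'I_n -> R) : (forall i, 0 < v i) ->
  (forall i, v i ^+ 2 = (w i / s + a i) * (w i / s + c i)) ->
  \sum_i h (v i) ^+ 2 <= (9 / 10 * E) ^+ 2 /\
  ((1 <= k)%N -> \sum_i h (v i) ^+ 2 <= (3 / 5 * E) ^+ 2).
Proof.
move=> v0 vE.
have H := halfstep_sum_after_step W_gt0 v0 dir_sum dir_inner vE G_ge0 rG proxW.
have Q0 : 0 <= k%:R ^+ 2 / 2 + k.+1%:R :> R.
  by rewrite addr_ge0 // divr_ge0 ?sqr_ge0.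
have F0 : 0 <= (1 + 5 / 4 * E) ^+ 2 * E by rewrite mulr_ge0 ?sqr_ge0.
have bound : G ^+ 2 * (k%:R ^+ 2 / 2 + k.+1%:R) <=
    2 / 5 * (1 + 5 / 4 * E) ^+ 2 * E.
  by have := ler_wpM2l F0 (radius_quadratic E_le); rewrite /G; lra.
have lhs0 : 0 <= G ^+ 2 * (k%:R ^+ 2 / 2 + k.+1%:R).
  by rewrite mulr_ge0 ?sqr_ge0.
have contract q : 0 <= q -> 2 / 5 * (1 + 5 / 4 * E) ^+ 2 <= q ->
    \sum_i h (v i) ^+ 2 <= (q * E) ^+ 2.
  move=> q0 hq; apply: le_trans H _.
  rewrite ler_sqr ?nnegrE ?(mulr_ge0 q0) //.
  by apply: le_trans bound _; rewrite ler_wpM2r.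
split=> [|k1]; apply: contract; try by rewrite divr_ge0.
  by move: E_ge0 E25; nra.
have E425 : E <= 4 / 25 by have := exp_le k1; lra.
by move: E_ge0 E425; nra.
Qed.

(** The factor ((1 + s^2)/2)^2 = (1 - theta/2)^2 is used in place of the
    smaller s^2 = 1 - theta, because it is what the first iteration with r = 2
    attains. *)
Lemma scaled_step_gap :
  (k = 1%N -> \sum_i w i ^+ 2 = n%:R \/ \sum_i h (w i) ^+ 2 <= (3 / 5 * E) ^+ 2) ->
  s ^+ 2 * \sum_i (w i / s + a i) * (w i / s + c i) <=
    ((1 + s ^+ 2) / 2) ^+ 2 * (n%:R + k%:R ^+ 2 * E ^+ 2).
Proof.
move=> center.
have [q0 _] := step_defect dir_sum dir_inner.
have s20 : 0 <= s ^+ 2 by rewrite sqr_ge0.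
have s21 : s ^+ 2 <= 1 by rewrite expr_le1 // ltW.
have s2le : s ^+ 2 <= ((1 + s ^+ 2) / 2) ^+ 2 by have := sqr_ge0 (1 - s ^+ 2); lra.
have N0 : 0 <= n%:R + k%:R ^+ 2 * E ^+ 2 :> R.
  by rewrite addr_ge0 // mulr_ge0 ?sqr_ge0.
apply: (@le_trans _ _ (s ^+ 2 * \sum_i (w i / s + h (w i / s)) ^+ 2)).
  rewrite ler_wpM2l //; apply: ler_sum => i _.
  by rewrite (step_sqr (w i / s) (dir_sum i)) gerBl.
have generic : \sum_i (w i / s + h (w i / s)) ^+ 2 <= n%:R + k%:R ^+ 2 * E ^+ 2 ->
    s ^+ 2 * \sum_i (w i / s + h (w i / s)) ^+ 2 <=
    ((1 + s ^+ 2) / 2) ^+ 2 * (n%:R + k%:R ^+ 2 * E ^+ 2).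
  move=> /(ler_wpM2l s20) /le_trans; apply; exact: ler_wpM2r.
have rE1 : k.+1%:R * E <= 1 by move: rE; lra.
have [k0|k1|k2] := ltngtP k 1.
- have k0' : k = 0%N by apply/eqP; rewrite -leqn0 -ltnS.
  apply: generic; apply: (@le_trans _ _ (n%:R + k%:R ^+ 2 * G ^+ 2)).
    exact: newton_points_sum_le.
  by rewrite k0' expr2 !mul0r.
- apply: generic.
  have [j kj] : exists j, k = j.+2 by exists k.-2; case: k k1 => [|[]].
  have := E_le; have := proxW; rewrite /G kj => pW EE.
  have [l1 l2] := radius_linear EE.
  apply: newton_points_sum_le_large => //.
  by have := @exp_le 2; rewrite kj => /(_ isT); lra.
have [wn|cent] := center k2; last first.
  apply: generic; apply: newton_points_sum_le => //.
  apply: halfstep_rescale_le_centered => //.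
  by have := @exp_le 1; rewrite k2 => /(_ isT); lra.
have pr := prox; rewrite k2 in pr *.
rewrite newton_points_sum_first // mulr1n expr1n mul1r mulrDr lerD //.
  by rewrite mulrC.
apply: (@le_trans _ _ (s ^+ 4 * E ^+ 2)); first by rewrite ler_wpM2l // exprn_even_ge0.
rewrite ler_wpM2r ?sqr_ge0 //.
by nra.
Qed.

End ScaledStep.
End Proximity.

(** * Convexity and the Hessian *)

Section Inner.
Context {R : realType} {n : nat}.
Implicit Types u v w : 'cV[R]_n.

Lemma innerE u v : inner u v = \sum_i u i 0 * v i 0.
Proof. by rewrite /inner mxE; apply: eq_bigr => i _; rewrite mxE. Qed.

Lemma innerC u v : inner u v = inner v u.
Proof. by rewrite !innerE; apply: eq_bigr => i _; rewrite mulrC. Qed.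

Lemma innerDr u v w : inner u (v + w) = inner u v + inner u w.
Proof. by rewrite /inner mulmxDr mxE. Qed.

Lemma innerNr u v : inner u (- v) = - inner u v.
Proof. by rewrite /inner mulmxN mxE. Qed.

Lemma innerBr u v w : inner u (v - w) = inner u v - inner u w.
Proof. by rewrite innerDr innerNr. Qed.

Lemma innerZl c u v : inner (c *: u) v = c * inner u v.
Proof. by rewrite /inner linearZ /= -scalemxAl mxE. Qed.

Lemma inner0l v : inner 0 v = 0.
Proof. by rewrite /inner trmx0 mul0mx mxE. Qed.

Lemma inner_ge0 u v : vnneg u -> vnneg v -> 0 <= inner u v.
Proof. by move=> u0 v0; rewrite innerE sumr_ge0 // => i _; rewrite mulr_ge0. Qed.

Lemma cV_sum_delta v : v = \sum_i v i 0 *: delta_mx i 0.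
Proof. by rewrite [LHS]matrix_sum_delta; apply: eq_bigr => i _; rewrite big_ord1. Qed.

End Inner.

Lemma inner_mulmxr (R : realType) m n (A : 'M[R]_(m, n)) (x : 'cV[R]_n) (y : 'cV[R]_m) :
  inner x (A^T *m y) = inner (A *m x) y.
Proof. by rewrite /inner trmx_mul mulmxA. Qed.

Section Convexity.
Context {R : realType} {n : nat}.
Variable f : 'cV[R]_n -> R.

Lemma derive_grad x v : differentiable f x -> 'D_v f x = inner (grad f x) v.
Proof.
move=> df; rewrite deriveE // {1}(cV_sum_delta v) linear_sum innerE.
by apply: eq_bigr => i _; rewrite linearZ /= mxE deriveE // mulrC.
Qed.

Lemma derive_grad_hessian x v :
  differentiable (grad f) x -> 'D_v (grad f) x = hessian f x *m v.
Proof.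
move=> df; rewrite deriveE // {1}(cV_sum_delta v) linear_sum.
apply/matrixP => i j; rewrite !ord1 summxE mxE.
apply: eq_bigr => k _; rewrite linearZ /= -deriveE //.
rewrite derive_mx; last exact: diff_derivable.
by rewrite !mxE mulrC.
Qed.

Hypothesis f_convex : convex_function (E := 'cV[R]_n) setT f.

Lemma convex_chord x y (t : R) : 0 < t -> t <= 1 ->
  f (x + t *: (y - x)) <= f x + t * (f y - f x).
Proof.
move=> t0 t1.
have := f_convex (Itv01 (ltW t0) t1) (in_setT y) (in_setT x).
rewrite /conv /=.
rewrite (_ : t *: y + (1 - t) *: x = x + t *: (y - x)); last first.
  by rewrite scalerBl scale1r scalerBr addrCA.
move=> /le_trans; apply.
have -> : f x + t * (f y - f x) = t * f y + (1 - t) * f x by ring.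
exact: lexx.
Qed.

(** The chord inequality, divided by t, as t tends to 0 from the right. *)
Lemma convex_grad_ineq x y : differentiable f x ->
  f x + inner (grad f x) (y - x) <= f y.
Proof.
move=> df; rewrite -derive_grad // -lerBrDl.
have dv : derivable f x (y - x) by exact: diff_derivable.
have /cvg_dnbhs_at_right := dv => dvr.
apply: (cvgr_to_le dvr); near=> h.
have h0 : 0 < h by [].
have h1 : h <= 1 by near: h; exact: nbhs_right_le.
have := convex_chord x y h0 h1.
rewrite /= [h *: _ + x]addrC => chord.
change (h^-1 * (f (x + h *: (y - x)) - f x) <= f y - f x).
by rewrite ler_pdivrMl //; lra.
Unshelve. all: by end_near. Qed.

Lemma grad_monotone x y : differentiable f x -> differentiable f y ->
  0 <= inner (y - x) (grad f y - grad f x).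
Proof.
move=> dx dy; have := convex_grad_ineq y dx; have := convex_grad_ineq x dy.
rewrite -(opprB y x) innerNr innerBr !(innerC (y - x)); lra.
Qed.

Hypothesis f_diff : twice_differentiable f.

(** The difference quotient of the gradient along v has a nonnegative product
    with v because the gradient is monotone; the inequality passes to the
    limit. *)
Lemma hessian_psd x v : 0 <= inner v (hessian f x *m v).
Proof.
have [df dg] := f_diff.
rewrite -derive_grad_hessian //.
have dv : derivable (grad f) x v by exact: diff_derivable.
have cv : inner v (h^-1 *: (grad f (h *: v + x) - grad f x)) @[h --> 0^'] -->
    inner v ('D_v (grad f) x).
  rewrite innerE; under eq_fun do rewrite innerE.
  have add_cont : continuous (fun z : R * R => z.1 + z.2).
    exact: add_continuous.
  apply: (@cvg_big _ _ _ 0 xpredT add_cont) => i _; apply: cvgMl_tmp.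
  apply: (@cvg_comp _ _ _ _ (fun M : 'cV[R]_n => M i 0) _ _ _ dv).
  exact: coord_continuous.
apply: (cvgr_to_ge cv); near=> h.
have h0 : h != 0 by near: h; exact: nbhs_dnbhs_neq.
have := grad_monotone (df x) (df (h *: v + x)).
rewrite addrK innerZl innerC => H.
rewrite innerC innerZl.
rewrite (_ : h^-1 * _ = h^-1 ^+ 2 * (h * inner (grad f (h *: v + x) - grad f x) v)).
  by rewrite mulr_ge0 // sqr_ge0.
by rewrite expr2 -mulrA mulKf.
Unshelve. all: by end_near. Qed.

End Convexity.

(** * Unique solvability of the Newton system *)

Section NewtonSystem.
Context {R : realType} {m n : nat}.
Variables (A : 'M[R]_(m, n)) (f : 'cV[R]_n -> R).
Hypothesis A_full : \rank A = m.
Hypothesis f_convex : convex_function (E := 'cV[R]_n) setT f.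
Hypothesis f_diff : twice_differentiable f.

Lemma vmulE (u v : 'cV[R]_n) : vmul u v = diag_mx u^T *m v.
Proof. by apply/matrixP => i j; rewrite mul_diag_mx !mxE !ord1. Qed.

(** On the kernel of A, the component A^T dy of dz is orthogonal to dx. *)
Lemma newton_inner_ge0 r x z mu dx dy dz :
  newton_system r A f x z mu (dx, dy, dz) -> 0 <= inner dx dz.
Proof.
case=> [Adx dzE _].
have -> : dz = hessian f x *m dx - A^T *m dy by rewrite -dzE addrC addKr.
by rewrite innerBr inner_mulmxr Adx inner0l subr0; exact: hessian_psd.
Qed.

(** The Newton system with dz = H dx - A^T dy eliminated. *)
Definition newton_matrix (x z : 'cV[R]_n) : 'M[R]_(n + m) :=
  block_mx (diag_mx z^T + diag_mx x^T *m hessian f x) (- (diag_mx x^T *m A^T))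
           A 0.

Lemma newton_systemE r x z mu dx dy dz :
  newton_system r A f x z mu (dx, dy, dz) <->
  dz = hessian f x *m dx - A^T *m dy /\
  newton_matrix x z *m col_mx dx dy =
    col_mx (mu *: vmul (wvec x z mu) (pvec r (wvec x z mu))) 0.
Proof.
have lhs : newton_matrix x z *m col_mx dx dy =
  col_mx (vmul z dx + vmul x (hessian f x *m dx - A^T *m dy)) (A *m dx).
  rewrite mul_block_col mul0mx addr0 !vmulE mulmxDl mulmxBr mulNmx !mulmxA.
  by rewrite addrA.
rewrite lhs; split=> [[Adx dzE cE]|[dzE /eq_col_mx[cE Adx]]].
  have dzE' : dz = hessian f x *m dx - A^T *m dy by rewrite -dzE addrC addKr.
  by split=> //; rewrite -dzE' cE Adx.
by split=> //; [rewrite dzE addrC subrK | rewrite dzE].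
Qed.

(** In the kernel dz = - (z/x) dx componentwise, so that dx^T dz >= 0 forces
    dx = 0; then A^T dy = 0, and dy = 0 because A has full row rank. *)
Lemma newton_matrix_unit x z : vpos x -> vpos z -> newton_matrix x z \in unitmx.
Proof.
move=> x0 z0; rewrite -unitmx_tr -row_free_unit; apply: inj_row_free => v vM.
have : newton_matrix x z *m v^T = 0.
  by rewrite -[newton_matrix _ _]trmxK -trmx_mul vM trmx0.
rewrite -[v^T]vsubmxK; set dx := usubmx _; set dy := dsubmx _.
rewrite mul_block_col mul0mx addr0 -[0]vsubmxK => /eq_col_mx[].
rewrite !linear0 => comp Adx.
pose dz := hessian f x *m dx - A^T *m dy.
have {}comp i : dz i 0 = - (z i 0 / x i 0 * dx i 0).
  have : (vmul z dx + vmul x dz) i 0 = 0.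
    rewrite !vmulE /dz mulmxBr.
    have := congr1 (fun M : 'cV_n => M i 0) comp.
    by rewrite mulmxDl mulNmx !mulmxA addrA [RHS]mxE.
  have xi0 := lt0r_neq0 (x0 i).
  rewrite !mxE => /eqP; rewrite addrC addr_eq0 => /eqP E.
  by apply: (mulfI xi0); rewrite E; field.
have ge0 : 0 <= inner dx dz.
  by rewrite innerBr inner_mulmxr Adx inner0l subr0; exact: hessian_psd.
have dx0 : dx = 0.
  apply/matrixP => i j; rewrite ord1 [RHS]mxE.
  pose F k := z k 0 / x k 0 * dx k 0 ^+ 2.
  have F0 k : 0 <= F k by rewrite mulr_ge0 ?sqr_ge0 // divr_ge0 // ltW.
  have : \sum_k F k == 0.
    rewrite eq_le sumr_ge0 // andbT -oppr_ge0.
    move: ge0; rewrite innerE -sumrN; congr (_ <= _).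
    by apply: eq_bigr => k _; rewrite comp /F; ring.
  rewrite psumr_eq0 // => /allP /(_ i (mem_index_enum _)) /=.
  by rewrite mulf_eq0 sqrf_eq0 gt_eqF ?divr_gt0 //= => /eqP.
have Ady : A^T *m dy = 0.
  apply/matrixP => i j; have := comp i; rewrite /dz dx0 mulmx0 sub0r ord1.
  by rewrite !mxE mulr0 oppr0 => /eqP; rewrite oppr_eq0 => /eqP.
have dy0 : dy = 0.
  have : dy^T *m A = 0 by rewrite -[A]trmxK -trmx_mul Ady trmx0.
  have Afree : row_free A by rewrite /row_free A_full.
  move=> /eqP; rewrite mulmx_free_eq0 // => /eqP dyT.
  by rewrite -[dy]trmxK dyT trmx0.
by rewrite -[v]trmxK -[v^T]vsubmxK -/dx -/dy dx0 dy0 col_mx0 trmx0.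
Qed.

Lemma newton_system_solvable r x z mu : vpos x -> vpos z ->
  exists dx dy dz, unique (newton_system r A f x z mu) (dx, dy, dz).
Proof.
move=> x0 z0; have Mu := newton_matrix_unit x0 z0.
pose g : 'cV[R]_(n + m) :=
  col_mx (mu *: vmul (wvec x z mu) (pvec r (wvec x z mu))) 0.
pose d := invmx (newton_matrix x z) *m g.
exists (usubmx d), (dsubmx d), (hessian f x *m usubmx d - A^T *m dsubmx d).
split=> [|[[dx dy] dz] /newton_systemE[-> E]].
  by apply/newton_systemE; split; rewrite // vsubmxK mulKVmx.
have -> : d = col_mx dx dy by rewrite /d /g -E mulKmx.
by rewrite col_mxKu col_mxKd.
Qed.

End NewtonSystem.

(** * The duality gap *)

Section Duality.
Context {R : realType} {m n : nat}.
Variables (A : 'M[R]_(m, n)) (b : 'cV[R]_m) (f : 'cV[R]_n -> R).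
Hypothesis f_convex : convex_function (E := 'cV[R]_n) setT f.
Hypothesis f_diff : twice_differentiable f.

Lemma duality_gap x u y z : A *m x = b -> A^T *m y + z = grad f u ->
  inner b y = inner x (grad f u) - inner x z.
Proof. by move=> <- <-; rewrite innerDr inner_mulmxr addrK. Qed.

(** Convexity at u bounds f x from below by its linearization at u. *)
Lemma weak_duality x u y z : primal_feasible A b x -> dual_feasible A f u y z ->
  dual_objective b f u y <= f x.
Proof.
move=> [Ax x0] [dE z0]; rewrite /dual_objective (duality_gap Ax dE).
have := convex_grad_ineq f_convex x (f_diff.1 u).
have := inner_ge0 x0 z0; rewrite innerBr !(innerC (grad f u)); lra.
Qed.

Lemma eps_optimal_of_gap eps x y z :
  A *m x = b -> vnneg x -> vnneg z -> A^T *m y + z = grad f x ->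
  inner x z <= eps -> eps_optimal A b f eps x y z.
Proof.
move=> Ax x0 z0 dE gap.
have obj : dual_objective b f x y = f x - inner x z.
  by rewrite /dual_objective (duality_gap Ax dE); lra.
have pf : primal_feasible A b x by [].
have df : dual_feasible A f x y z by [].
split=> // [x' pf'|x' y' z' df'].
  have := weak_duality pf' df; rewrite obj; lra.
have := weak_duality pf df'; rewrite obj; lra.
Qed.

End Duality.

(** * One iteration of the algorithm *)

Section NewtonStep.
Context {R : realType} {n : nat}.
Implicit Types x z dx dz : 'cV[R]_n.

(** The constant n + (r-1)^2 / e^(2r) of the iteration bound, with k = r - 1
    and E = e^(-r). *)
Definition gap_weight (k : nat) (E : R) : R := n%:R + k%:R ^+ 2 * E ^+ 2.

Lemma wvec_sqr x z mu i : vpos x -> vpos z -> 0 < mu ->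
  wvec x z mu i 0 ^+ 2 = x i 0 * z i 0 / mu.
Proof.
by move=> x0 z0 mu0; rewrite !mxE sqr_sqrtr // divr_ge0 ?mulr_ge0 // ltW.
Qed.

Lemma wvec_gt0 x z mu i : vpos x -> vpos z -> 0 < mu -> 0 < wvec x z mu i 0.
Proof. by move=> x0 z0 mu0; rewrite !mxE sqrtr_gt0 divr_gt0 ?mulr_gt0. Qed.

Lemma sum_wvec_sqr x z mu : vpos x -> vpos z -> 0 < mu ->
  \sum_i wvec x z mu i 0 ^+ 2 = inner x z / mu.
Proof.
move=> x0 z0 mu0; rewrite innerE mulr_suml.
by apply: eq_bigr => i _; rewrite wvec_sqr.
Qed.

Lemma pvec_halfstep k (w : 'cV[R]_n) i :
  pvec k.+1 w i 0 = 2 * halfstep k.+1 (w i 0).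
Proof. by rewrite mxE /halfstep /= -{1}[2]mulr1 -mulrBr mulrA. Qed.

Lemma Gam_ge0 r x z mu : 0 <= Gam r x z mu.
Proof. by rewrite divr_ge0 ?sqrtr_ge0. Qed.

Lemma Gam_sqr k x z mu :
  Gam k.+1 x z mu ^+ 2 = \sum_i halfstep k.+1 (wvec x z mu i 0) ^+ 2.
Proof.
rewrite /Gam expr_div_n /enorm sqr_sqrtr; last first.
  by rewrite innerE sumr_ge0 // => i _; rewrite -expr2 sqr_ge0.
rewrite innerE mulr_suml; apply: eq_bigr => i _.
by rewrite pvec_halfstep; field.
Qed.

Lemma Gam_le k x z mu q : 0 <= q ->
  (Gam k.+1 x z mu <= q) =
  (\sum_i halfstep k.+1 (wvec x z mu i 0) ^+ 2 <= q ^+ 2).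
Proof. by move=> q0; rewrite -Gam_sqr ler_sqr ?nnegrE ?Gam_ge0. Qed.

(** In scaled coordinates this is the preceding analysis: a and c are the
    scaled displacements, and x + dx, z + dz are positive multiples of
    w/s + a, w/s + c. *)
Lemma newton_step k x z dx dz mu E theta (mu' := (1 - theta) * mu) :
  vpos x -> vpos z -> 0 < mu -> 0 < E -> E <= (2 / 5) ^+ k.+1 ->
  0 < theta -> theta < 1 -> theta <= E ^+ 2 -> n%:R * theta ^+ 2 <= E ^+ 4 ->
  Gam k.+1 x z mu <= E ->
  (k = 1%N -> inner x z = n%:R * mu \/ Gam k.+1 x z mu <= 3 / 5 * E) ->
  vmul z dx + vmul x dz =
    mu' *: vmul (wvec x z mu') (pvec k.+1 (wvec x z mu')) ->
  0 <= inner dx dz ->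
  [/\ vpos (x + dx), vpos (z + dz),
      Gam k.+1 (x + dx) (z + dz) mu' <= 9 / 10 * E,
      ((1 <= k)%N -> Gam k.+1 (x + dx) (z + dz) mu' <= 3 / 5 * E) &
      inner (x + dx) (z + dz) <= mu * (1 - theta / 2) ^+ 2 * gap_weight k E].
Proof.
move=> x0 z0 mu0 E0 Ele th0 th1 thE thn prox center newton dxdz0.
pose s := Num.sqrt (1 - theta).
have s2 : s ^+ 2 = 1 - theta by rewrite sqr_sqrtr // subr_ge0 ltW.
have s0 : 0 < s by rewrite sqrtr_gt0 subr_gt0.
have s1 : s <= 1 by rewrite -(@expr_le1 _ 2%N) ?s2 ?gerBl // ltW.
have mu'0 : 0 < mu' by rewrite mulr_gt0 // subr_gt0.
pose w i := wvec x z mu i 0.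
have w0 i : 0 < w i by exact: wvec_gt0.
have wE i : wvec x z mu' i 0 = w i / s.
  apply/eqP; rewrite -(@eqrXn2 _ 2%N) ?(ltW (divr_gt0 _ _)) ?(ltW (wvec_gt0 _ _ _ _)) //.
  rewrite expr_div_n s2 !wvec_sqr //; apply/eqP.
  by rewrite /mu'; field; rewrite (lt0r_neq0 mu0) subr_eq0 gt_eqF.
have W2 i : (w i / s) ^+ 2 = x i 0 * z i 0 / mu' by rewrite -wE wvec_sqr.
pose a i := w i / s * (dx i 0 / x i 0).
pose c i := w i / s * (dz i 0 / z i 0).
have xn i := lt0r_neq0 (x0 i).
have zn i := lt0r_neq0 (z0 i).
have mun := lt0r_neq0 mu'0.
have Wn i : w i / s != 0 by rewrite lt0r_neq0 // divr_gt0.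
have ac i : a i + c i = 2 * halfstep k.+1 (w i / s).
  have := congr1 (fun M : 'cV_n => M i 0) newton.
  rewrite mxE [vmul _ _ i 0]mxE [vmul x dz i 0]mxE mxE [vmul _ _ i 0]mxE.
  rewrite pvec_halfstep wE => eqn.
  apply: (mulfI (mulf_neq0 mun (Wn i))).
  rewrite -[RHS]mulrA -eqn /a /c -mulrDr mulrA -[mu' * _ * _]mulrA -expr2 W2.
  by field; rewrite mun xn zn.
have acE i : a i * c i = dx i 0 * dz i 0 / mu'.
  rewrite /a /c mulrACA -expr2 W2; by field; rewrite mun xn zn.
have ac0 : 0 <= \sum_i a i * c i.
  under eq_bigr do rewrite acE.
  by rewrite -mulr_suml -innerE divr_ge0 // ltW.
have d1 : 1 - s ^+ 2 <= E ^+ 2 by rewrite s2 subKr.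
have d2 : n%:R * (1 - s ^+ 2) ^+ 2 <= E ^+ 4 by rewrite s2 subKr.
have pr : \sum_i halfstep k.+1 (w i) ^+ 2 <= E ^+ 2 by rewrite -Gam_le // ltW.
have pos := scaled_step_gt0 w0 s0 s1 E0 Ele d1 d2 pr ac ac0.
have xE i : (x + dx) i 0 = x i 0 / (w i / s) * (w i / s + a i).
  by rewrite mxE /a; field; rewrite xn lt0r_neq0 //= lt0r_neq0.
have zE i : (z + dz) i 0 = z i 0 / (w i / s) * (w i / s + c i).
  by rewrite mxE /c; field; rewrite zn lt0r_neq0 //= lt0r_neq0.
have x'0 : vpos (x + dx).
  by move=> i; rewrite xE mulr_gt0 ?(pos i).1 // divr_gt0 // divr_gt0.
have z'0 : vpos (z + dz).
  by move=> i; rewrite zE mulr_gt0 ?(pos i).2 // divr_gt0 // divr_gt0.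
have prodE i : (x + dx) i 0 * (z + dz) i 0 / mu' =
    (w i / s + a i) * (w i / s + c i).
  rewrite xE zE mulrACA [x i 0 / _ * _]mulrACA -invfM -expr2 W2.
  by field; rewrite mun xn zn lt0r_neq0.
have v0 i : 0 < wvec (x + dx) (z + dz) mu' i 0 by exact: wvec_gt0.
have vE i : wvec (x + dx) (z + dz) mu' i 0 ^+ 2 =
    (w i / s + a i) * (w i / s + c i) by rewrite wvec_sqr.
have [p1 p2] := scaled_step_prox w0 s0 s1 E0 Ele d1 d2 pr ac ac0 v0 vE.
split=> //.
- by rewrite Gam_le // mulr_ge0 ?(ltW E0) // divr_ge0.
- by move=> /p2; rewrite Gam_le // mulr_ge0 ?(ltW E0) // divr_ge0.
have cen : k = 1%N -> \sum_i w i ^+ 2 = n%:R \/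
    \sum_i halfstep k.+1 (w i) ^+ 2 <= (3 / 5 * E) ^+ 2.
  move=> /center[gap|cent]; [left|right].
    by rewrite /w sum_wvec_sqr // gap mulfK // lt0r_neq0.
  by rewrite -Gam_le // mulr_ge0 ?(ltW E0) // divr_ge0.
have := scaled_step_gap w0 s0 s1 E0 Ele d1 d2 pr ac ac0 cen.
move=> /(ler_wpM2l (ltW mu0)).
have -> : mu * (s ^+ 2 * \sum_i (w i / s + a i) * (w i / s + c i)) =
    inner (x + dx) (z + dz).
  rewrite s2 mulrA [mu * _]mulrC -/mu' mulr_sumr innerE.
  by apply: eq_bigr => i _; rewrite -prodE mulrC divfK.
move=> /le_trans; apply.
rewrite mulrA s2 /gap_weight.
by have -> : (1 + (1 - theta)) / 2 = 1 - theta / 2 by field.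
Qed.

End NewtonStep.

(** * The number of iterations *)

Section Radius.
Context {R : realType}.

(** e = (e^(1/6))^6 >= (7/6)^6. *)
Lemma expR1_ge : 5 / 2 <= expR 1 :> R.
Proof.
have -> : expR 1 = expR 6^-1 ^+ 6 :> R by rewrite -expRM_natl divff.
have h : 7 / 6 <= expR 6^-1 :> R.
  by apply: le_trans (expR_ge1Dx _); lra.
apply: (@le_trans _ _ ((7 / 6) ^+ 6)); first by lra.
by rewrite lerXn2r ?nnegrE ?divr_ge0 // expR_ge0.
Qed.

Lemma expR_natV_le r : (expR r%:R)^-1 <= (2 / 5) ^+ r :> R.
Proof.
rewrite -[r%:R]mulr1 expRM_natl -exprVn lerXn2r ?nnegrE ?invr_ge0 ?expR_ge0 //.
by rewrite -[2 / 5]invf_div lef_pV2 ?posrE ?expR_gt0 ?divr_gt0 // expR1_ge.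
Qed.

End Radius.

Section Algorithm.
Context {R : realType} {m n k : nat}.
Variables (A : 'M[R]_(m, n)) (b : 'cV[R]_m) (f : 'cV[R]_n -> R).
Hypothesis A_full : \rank A = m.
Hypothesis f_convex : convex_function (E := 'cV[R]_n) setT f.
Hypothesis f_diff : twice_differentiable f.
Variables (E theta eps mu0 : R).
Hypothesis E_gt0 : 0 < E.
Hypothesis E_le : E <= (2 / 5) ^+ k.+1.
Hypothesis theta_gt0 : 0 < theta.
Hypothesis theta_lt1 : theta < 1.
Hypothesis theta_le : theta <= E ^+ 2.
Hypothesis theta_sum : n%:R * theta ^+ 2 <= E ^+ 4.

Let rho : R := (1 - theta / 2) ^+ 2.
Let W : R := gap_weight (n := n) k E.

(** The disjunction for k = 1, that is r = 2, tells the first iteration (exact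
    duality gap) from the later ones (improved proximity). *)
Definition loop_invariant (j : nat) (s : @state R m n) : Prop :=
  [/\ A *m st_x s = b, vpos (st_x s) /\ vpos (st_z s),
      0 < st_mu s <= mu0 * rho ^+ j,
      Gam k.+1 (st_x s) (st_z s) (st_mu s) <= E /\
      (k = 1%N -> inner (st_x s) (st_z s) = n%:R * st_mu s \/
         Gam k.+1 (st_x s) (st_z s) (st_mu s) <= 3 / 5 * E) &
      inner (st_x s) (st_z s) <= mu0 * rho ^+ j * W].

Lemma gap_weight_ge0 : 0 <= W.
Proof. by rewrite addr_ge0 // mulr_ge0 ?sqr_ge0. Qed.

Lemma loop_invariant_step j s : loop_invariant j s ->
  exists s', iteration k.+1 A f theta s s' /\ loop_invariant j.+1 s'.
Proof.
move=> [Ax [x0 z0] /andP[mu_gt0 mu_le] [prox center] gap].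
set x := st_x s in Ax x0 prox center gap *.
set z := st_z s in z0 prox center gap *.
have [dx [dy [dz uniq]]] :=
  newton_system_solvable A_full f_convex f_diff k.+1 ((1 - theta) * st_mu s) x0 z0.
exists (State (x + dx) (st_y s + dy) (z + dz) ((1 - theta) * st_mu s)).
split; first by exists dx, dy, dz.
have newton := uniq.1.
have [Adx _ comp] := newton.
have [x'0 z'0 p1 p2 gap'] := newton_step x0 z0 mu_gt0 E_gt0 E_le theta_gt0
  theta_lt1 theta_le theta_sum prox center comp
  (newton_inner_ge0 f_convex f_diff newton).
(* mu shrinks by 1 - theta, which is below the rate rho of the duality gap *)
have rho_ge : 1 - theta <= rho by rewrite /rho; have := sqr_ge0 theta; lra.
have rho0 : 0 <= rho by rewrite sqr_ge0.
have mu_rho : st_mu s * rho <= mu0 * rho ^+ j.+1.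
  by rewrite exprSr mulrA ler_wpM2r.
split=> //=.
- by rewrite mulmxDr Adx addr0.
- rewrite mulr_gt0 ?subr_gt0 //=; apply: le_trans mu_rho.
  by rewrite mulrC ler_pM2l.
- split; first by apply: le_trans p1 _; move: E_gt0; lra.
  by move=> k1; right; apply: p2; rewrite k1.
- by apply: le_trans gap' _; rewrite ler_wpM2r // gap_weight_ge0.
Qed.

(** The loop may stop before the d iterations allowed by the bound; once the
    bound itself is below eps, it has to stop. *)
Lemma terminates_within d j s : loop_invariant j s ->
  mu0 * rho ^+ (j + d) * W <= eps ->
  exists i t, [/\ terminates k.+1 A f eps theta s i t, (i <= d)%N,
    A *m st_x t = b, vpos (st_x t) /\ vpos (st_z t) &
    inner (st_x t) (st_z t) <= eps].
Proof.
elim: d j s => [|d IH] j s inv small.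
  have [Ax pos _ _ gap] := inv.
  have le_eps : inner (st_x s) (st_z s) <= eps.
    by apply: le_trans gap _; rewrite -[j]addn0.
  by exists 0%N, s; split=> //; exact: terminates_stop.
have [le_eps|gt_eps] := lerP (inner (st_x s) (st_z s)) eps.
  have [Ax pos _ _ _] := inv.
  by exists 0%N, s; split=> //; exact: terminates_stop.
have [s' [it inv']] := loop_invariant_step inv.
have [|i [t [ti id Ax pos gap]]] := IH j.+1 s' inv'; first by rewrite addSnnS.
by exists i.+1, t; split=> //; exact: terminates_step it ti.
Qed.

Lemma gap_bound_small D : 0 < mu0 -> 0 < eps -> 0 < W ->
  ln (mu0 * W / eps) <= theta * D%:R -> mu0 * rho ^+ D * W <= eps.
Proof.
move=> mu0_gt0 eps0 W0 lnle.
have M0 : 0 < mu0 * W / eps by rewrite divr_gt0 // mulr_gt0.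
have h : rho <= expR (- theta).
  rewrite (_ : - theta = 2%:R * (- theta / 2)); last by field.
  rewrite expRM_natl lerXn2r ?nnegrE ?expR_ge0 //.
    by move: theta_lt1 theta_gt0; lra.
  by apply: le_trans (expR_ge1Dx _); lra.
have : rho ^+ D <= (mu0 * W / eps)^-1.
  apply: (@le_trans _ _ (expR (- theta) ^+ D)).
    by rewrite lerXn2r ?nnegrE ?expR_ge0 // sqr_ge0.
  rewrite -expRM_natl mulrN expRN lef_pV2 ?posrE ?expR_gt0 //.
  by rewrite -(lnK M0) ler_expR [D%:R * _]mulrC.
move=> /(ler_wpM2l (ltW (mulr_gt0 mu0_gt0 W0))).
have -> : mu0 * W * (mu0 * W / eps)^-1 = eps.
  by field; rewrite !lt0r_neq0.
by rewrite mulrAC.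
Qed.

End Algorithm.

Theorem theorem1 (R : realType) (m n : nat)
    (A : 'M[R]_(m, n)) (b : 'cV[R]_m) (f : 'cV[R]_n -> R)
    (hmn : (m < n)%N) (hA : \rank A = m)
    (hconv : convex_function (E := 'cV[R]_n) setT f)
    (hdiff : twice_differentiable f)
    (r : nat) (hr : (1 <= r)%N)
    (eps : R) (heps : 0 < eps)
    (x0 : 'cV[R]_n) (y0 : 'cV[R]_m) (z0 : 'cV[R]_n)
    (hfeas : strictly_feasible A b f x0 y0 z0)
    (mu0 : R) (hmu0 : mu0 = inner x0 z0 / n%:R)
    (hGam : Gam r x0 z0 mu0 < 1 / expR r%:R)
    (theta : R) (htheta : theta = 1 / (expR (2 * r%:R) * Num.sqrt n%:R)) :
  exists (k : nat) (t : state),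
    [/\ terminates r A f eps theta (State x0 y0 z0 mu0) k t,
        k%:Z <= Num.max 0 (Num.ceil (expR (2 * r%:R) * Num.sqrt n%:R *
          ln (mu0 * (n%:R + (r%:R - 1) ^+ 2 / expR (2 * r%:R)) / eps))),
        [/\ A *m st_x t = b, vpos (st_x t), vpos (st_z t) &
            inner (st_x t) (st_z t) <= eps] &
        A^T *m st_y t + st_z t = grad f (st_x t) ->
          eps_optimal A b f eps (st_x t) (st_y t) (st_z t)].
Proof.
case: r hr hGam htheta => // k _ hGam htheta.
have [Ax x0_gt0 _ z0_gt0] := hfeas.
have n_gt0 : (0 < n)%N := leq_trans (ltn0Sn m) hmn.
have nR0 : 0 < n%:R :> R by rewrite ltr0n.
have nn0 := lt0r_neq0 nR0.
set q := Num.sqrt n%:R in htheta *.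
have q2 : q ^+ 2 = n%:R by rewrite sqr_sqrtr // ltW.
have q0 : 0 < q by rewrite sqrtr_gt0.
have q1 : 1 <= q by rewrite -(@expr_ge1 _ 2%N) ?q2 ?ler1n // ltW.
set E : R := (expR k.+1%:R)^-1.
have E0 : 0 < E by rewrite invr_gt0 expR_gt0.
have Ele : E <= (2 / 5) ^+ k.+1 := expR_natV_le k.+1.
have E2 : expR (2 * k.+1%:R) = (E ^+ 2)^-1 by rewrite expRM_natl /E exprVn invrK.
rewrite E2 in htheta *.
have En := lt0r_neq0 E0; have qn := lt0r_neq0 q0.
have thE : theta = E ^+ 2 / q by rewrite htheta; field; rewrite qn En.
have th0 : 0 < theta by rewrite thE divr_gt0 // exprn_gt0.
have thle : theta <= E ^+ 2 by rewrite thE ler_pdivrMr // ler_peMr // sqr_ge0.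
have E25 : E <= 2 / 5.
  by apply: le_trans Ele _; rewrite ler_iXnr //; lra.
have th1 : theta < 1 by apply: (le_lt_trans thle); nra.
have thn : n%:R * theta ^+ 2 <= E ^+ 4.
  rewrite -q2 thE (_ : q ^+ 2 * (E ^+ 2 / q) ^+ 2 = E ^+ 4) //.
  by field.
have mu_gt0 : 0 < mu0.
  rewrite hmu0 divr_gt0 // innerE (bigD1 (Ordinal n_gt0)) //= ltr_pwDl //.
    by rewrite mulr_gt0.
  by rewrite sumr_ge0 // => i _; rewrite mulr_ge0 // ltW.
have gap0 : inner x0 z0 = n%:R * mu0 by rewrite hmu0 mulrC divfK.
pose W := gap_weight (n := n) k E.
have W0 : 0 < W by rewrite ltr_pwDl // mulr_ge0 ?sqr_ge0.
have WE : n%:R + (k.+1%:R - 1) ^+ 2 / (E ^+ 2)^-1 = W.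
  by rewrite invrK -natr1 addrK.
rewrite WE.
set L := (E ^+ 2)^-1 * q * ln (mu0 * W / eps).
pose K : int := Num.max 0 (Num.ceil L).
pose D := `|K|%N.
have DE : D%:Z = K by rewrite gez0_abs // le_max lexx.
have DL : L <= D%:R.
  apply: le_trans (ceil_ge L) _.
  by rewrite -[D%:R]/(D%:Z%:~R) ler_int DE le_max lexx orbT.
have small : mu0 * (1 - theta / 2) ^+ 2 ^+ (0 + D) * W <= eps.
  apply: gap_bound_small => //.
  rewrite add0n; have := ler_wpM2l (ltW th0) DL.
  rewrite /L mulrA (_ : theta * ((E ^+ 2)^-1 * q) = 1) ?mul1r //.
  by rewrite thE; field; rewrite En qn.
have inv : loop_invariant (k := k) A b E theta mu0 0 (State x0 y0 z0 mu0).
  split=> //=; first by rewrite mu_gt0 expr0 mulr1 lexx.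
    by split; [rewrite /E -div1r ltW | left].
  by rewrite expr0 mulr1 gap0 mulrC ler_pM2l // /gap_weight lerDl mulr_ge0 ?sqr_ge0.
have [i [t [ti id Axt [xt zt] gap]]] :=
  terminates_within hA hconv hdiff E0 Ele th0 th1 thle thn inv small.
exists i, t; split=> //; first by rewrite -/K -DE lez_nat.
move=> dual; apply: eps_optimal_of_gap => // j; exact: ltW.
Qed.
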